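(* Let $T>0$, let $(X,\|\cdot\|)$ be a Banach space and let $V(t,s),G(t,s)\in\mathcal{L}(X)$, $0\le s\le t\le T$. Assume: (i) there are $\omega\in\mathbb{R}$ and a family of norms $|||\cdot|||_t$, $0\le t\le T$, on $X$, uniformly equivalent to $\|\cdot\|$, such that $|||V(t,s)|||_{s,t}\le e^{\omega(t-s)}$ for all $0\le s\le t\le T$; (ii) there are $\alpha\ge1$ and $C_G>0$ such that $\|V(t,s)-G(t,s)\|_X\le C_G(t-s)^\alpha$ for all $0\le s\le t\le T$. Then: (1) There exists $\omega'\in\mathbb{R}$ such that $|||G(t,s)|||_{s,t}\le e^{\omega'(t-s)}$ for all $0\le s\le t\le T$. (2) There are $\omega'\in\mathbb{R}$ and $C_V,C_N>0$ with the following property. Let $n\in\mathbb{N}$, $0\le T_0\le T$, $\delta:=T_0/n$. Let $x_k,y_k\in X$ satisfy $x_{k+1}=V((k+1)\delta,k\delta)x_k$ and $y_{k+1}=G((k+1)\delta,k\delta)y_k$ for $0\le k\le n-1$. Then $$\|x_n-y_n\|\le C_Ve^{\omega'T_0}\Big(\|x_0-y_0\|+C_N\frac{T_0^\alpha}{n^{\alpha-1}}\|y_0\|\Big).$$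
   Context: $\mathcal{L}(X)$ is the space of bounded linear operators on $X$ with norm $\|\cdot\|_X$. A family of norms $|||\cdot|||_t$ is uniformly equivalent to $\|\cdot\|$ if there is $C>0$ with $C^{-1}\|x\|\le|||x|||_t\le C\|x\|$ for all $x\in X$ and all $t\in[0,T]$. $|||Q|||_{s,t}$ denotes the operator norm of $Q:(X,|||\cdot|||_s)\to(X,|||\cdot|||_t)$. *)

(* Defs.v *)
From Stdlib Require Import Reals.
From Coquelicot Require Export Coquelicot.
Open Scope R_scope.

(* A Banach space is a [CompleteNormedModule (scalar_field k)]: the scalars are
   either the real or the complex numbers. *)
Inductive scalar_kind := RealScalars | ComplexScalars.

Definition scalar_field (k : scalar_kind) : AbsRing :=
  match k with
  | RealScalars => R_AbsRing
  | ComplexScalars => C_AbsRing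
  end.

Record is_norm {K : AbsRing} {X : ModuleSpace K} (N : X -> R) : Prop := {
  is_norm_ge_0 : forall x, 0 <= N x;
  is_norm_triangle : forall x y, N (plus x y) <= N x + N y;
  is_norm_scal : forall (a : K) x, N (scal a x) = abs a * N x;
  is_norm_eq_0 : forall x, N x = 0 -> x = zero
}.

Definition uniformly_equivalent {K : AbsRing} {X : NormedModule K}
    (T : R) (N : R -> X -> R) : Prop :=
  exists C : R, 0 < C /\
    forall t x, 0 <= t <= T -> / C * norm x <= N t x <= C * norm x.

(* The operator norm of Q : (X, p) -> (Y, q), as an extended real: the infimum
   of an empty set of bounds is [p_infty]. *)
Definition op_norm {X Y : Type} (p : X -> R) (q : Y -> R) (Q : X -> Y) : Rbar :=
  Glb_Rbar (fun M => 0 <= M /\ forall x, q (Q x) <= M * p x).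

(* x ^ a for x >= 0 and a >= 0. [Rpower] alone will not do, because
   [Rpower 0 a = exp (a * ln 0) = 1] for every a. *)
Definition rpow (x a : R) : R :=
  if Req_EM_T x 0 then (if Req_EM_T a 0 then 1 else 0) else Rpower x a.

(* Main.v *)
Require Import Defs.
From Stdlib Require Import Reals Lra Lia.
From Coquelicot Require Import Coquelicot.
Open Scope R_scope.

(** In the moving norms [N t] the family [V] is quasi-contractive: a step of
    length [h] multiplies the norm by at most [exp (omega * h)]. Growth bounds
    with constant exactly 1 are the ones that survive composition of
    arbitrarily many steps, and they also survive an error of first order in
    the step: as [1 <= alpha], the distance [C_G * h ^ alpha] between [V] and
    [G] is at most a multiple of [h] on [[0, T]], and
    [exp (omega * h) + K * h <= exp ((|omega| + K) * h)]. This is part (1).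

    Part (2) is the usual argument that stability and consistency give
    convergence. With [d j = x j - y j] one has
    [d (j + 1) = V (d j) + (V - G) (y j)]. The first term is controlled by the
    growth bound of [V], the second by consistency and by the growth of [y j]
    known from part (1). Taking [omega' = |omega| + K], every step multiplies by
    the same [E = exp (omega' * delta) >= 1], so a discrete Gronwall argument
    gives [N (d j) <= E ^ j * (N (d 0) + j * b)], where [b] is proportional to
    [delta ^ alpha * |y 0|]. At [j = n] the factor [E ^ n] is
    [exp (omega' * T0)], and [n * delta ^ alpha = T0 ^ alpha / n ^ (alpha - 1)].
    The equivalence constant is paid only when a quantity enters or leaves the
    moving norms, so it is never compounded over the steps. *)

(** * Operator norms and powers *)

(** The infimum that defines the operator norm is a bound itself, so a bound on
    the norm can be used vector by vector. *)
Lemma op_norm_le_iff {X Y : Type} (p : X -> R) (q : Y -> R) (Q : X -> Y) (M : R)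
  (p_ge0 : forall x, 0 <= p x) (M_ge0 : 0 <= M) :
  Rbar_le (op_norm p q Q) M <-> forall x, q (Q x) <= M * p x.
Proof.
  unfold op_norm.
  set (bounds := fun M => 0 <= M /\ forall x, q (Q x) <= M * p x).
  destruct (Glb_Rbar_correct bounds) as [lb glb].
  split.
  - intros HM x.
    assert (close : forall eps, 0 < eps -> q (Q x) <= (M + eps) * p x).
    { intros eps Heps.
      apply Rnot_lt_le; intros Hlt.
      (* otherwise [M + eps] would be a lower bound of the admissible constants *)
      assert (Hle : Rbar_le (M + eps) (Glb_Rbar bounds)).
      { apply glb. intros M' [_ HM']. simpl.
        apply Rnot_lt_le; intros HM'lt.
        specialize (HM' x). pose proof (p_ge0 x). nra. }
      pose proof (Rbar_le_trans _ _ _ Hle HM) as Habs. simpl in Habs. lra. }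
    apply Rnot_lt_le; intros Hlt.
    (* this margin, times [p x], is less than half of the assumed gap; the
       [+ 1] covers [p x = 0] *)
    pose proof (p_ge0 x) as Hp.
    assert (Heps : 0 < (q (Q x) - M * p x) / (2 * (p x + 1))).
    { apply Rdiv_lt_0_compat; lra. }
    specialize (close _ Heps).
    assert (Hfrac : (q (Q x) - M * p x) / (2 * (p x + 1)) * (2 * (p x + 1))
                    = q (Q x) - M * p x) by (field; lra).
    nra.
  - intros HM. apply lb. split; assumption.
Qed.

Lemma rpow_ge_0 (x a : R) : 0 <= rpow x a.
Proof.
  unfold rpow.
  destruct (Req_EM_T x 0); [destruct (Req_EM_T a 0); lra|].
  unfold Rpower. left; apply exp_pos.
Qed.

(** A power of exponent at least 1 is Lipschitz at 0; this is the only place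
    where the bounded time horizon enters the stability estimate. *)
Lemma rpow_le_linear (T h a : R) (h_bounds : 0 <= h <= T) (a_ge1 : 1 <= a) :
  rpow h a <= Rpower T (a - 1) * h.
Proof.
  unfold rpow. destruct (Req_EM_T h 0) as [->|h_neq0].
  - destruct (Req_EM_T a 0); lra.
  - assert (h_pos : 0 < h) by lra.
    replace (Rpower h a) with (Rpower h (a - 1) * h).
    + apply Rmult_le_compat_r; [lra|].
      apply Rle_Rpower_l; lra.
    + rewrite <- (Rpower_1 h) at 2 by exact h_pos.
      rewrite <- Rpower_plus. f_equal; ring.
Qed.

(** Summing [n] local errors of order [a] loses exactly one power of [n]. *)
Lemma sum_rpow_steps (n : nat) (t a : R)
  (n_ge1 : (1 <= n)%nat) (t_ge0 : 0 <= t) (a_ge1 : 1 <= a) :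
  INR n * rpow (t / INR n) a = rpow t a / rpow (INR n) (a - 1).
Proof.
  assert (n_pos : 0 < INR n) by (apply lt_0_INR; lia).
  unfold rpow at 3. destruct (Req_EM_T (INR n) 0) as [|_]; [lra|].
  unfold rpow. destruct (Req_EM_T t 0) as [->|t_neq0].
  - replace (0 / INR n) with 0 by (field; lra).
    destruct (Req_EM_T 0 0) as [_|]; [|lra].
    destruct (Req_EM_T a 0); [lra|]. unfold Rdiv; ring.
  - assert (t_pos : 0 < t) by lra.
    destruct (Req_EM_T (t / INR n) 0) as [Habs|_].
    + pose proof (Rdiv_lt_0_compat t (INR n) t_pos n_pos). lra.
    + unfold Rdiv at 2. rewrite <- Rpower_Ropp.
      rewrite <- (exp_ln (INR n)) at 1 by exact n_pos.
      unfold Rpower, Rdiv at 1.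
      rewrite ln_mult, ln_Rinv by (try apply Rinv_0_lt_compat; lra).
      rewrite <- !exp_plus. f_equal; ring.
Qed.

(** * Growth and accumulation of errors *)

Lemma exp_nondecreasing (a b : R) : a <= b -> exp a <= exp b.
Proof.
  intros [Hlt | ->]; [left; apply exp_increasing, Hlt | right; reflexivity].
Qed.

(** The absolute value makes [exp (Rabs w * h) >= 1], so that the linear term
    can be multiplied by it and absorbed into [1 + K * h <= exp (K * h)]. *)
Lemma exp_add_linear_le (w K h : R) (K_ge0 : 0 <= K) (h_ge0 : 0 <= h) :
  exp (w * h) + K * h <= exp ((Rabs w + K) * h).
Proof.
  assert (w_le : exp (w * h) <= exp (Rabs w * h)).
  { apply exp_nondecreasing. apply Rmult_le_compat_r; [lra | apply RRle_abs]. }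
  assert (one_le : 1 <= exp (Rabs w * h)).
  { rewrite <- exp_0. apply exp_nondecreasing.
    apply Rmult_le_pos; [apply Rabs_pos | lra]. }
  assert (lin_le : 1 + K * h <= exp (K * h)).
  { apply exp_ineq1_le. }
  assert (Kh_ge0 : 0 <= K * h) by (apply Rmult_le_pos; lra).
  rewrite Rmult_plus_distr_r, exp_plus. nra.
Qed.

Lemma plus_minus {A : AbelianGroup} (a b : A) : plus a (minus b a) = b.
Proof.
  unfold minus. rewrite (plus_comm b), plus_assoc, plus_opp_r.
  apply plus_zero_l.
Qed.

(** The perturbation is measured in the fixed norm, so it crosses the
    equivalence twice. That costs a factor [C * C] in front of [L], but leaves
    the constant 1 in front of the exponential. *)
Lemma perturbed_growth {K : AbsRing} {X : NormedModule K}
  (p q : X -> R) (P Q : X -> X) (C c w L h : R)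
  (p_norm : is_norm p) (q_norm : is_norm q) (C_pos : 0 < C)
  (p_lower : forall x, norm x <= C * p x) (q_upper : forall x, q x <= C * norm x)
  (P_growth : forall x, q (P x) <= exp (w * h) * p x)
  (P_near_Q : forall x, norm (minus (P x) (Q x)) <= c * norm x)
  (c_ge0 : 0 <= c) (c_le : c <= L * h) (L_ge0 : 0 <= L) (h_ge0 : 0 <= h) (x : X) :
  q (Q x) <= exp ((Rabs w + C * C * L) * h) * p x.
Proof.
  assert (split_Q : Q x = plus (P x) (minus (Q x) (P x))).
  { symmetry; apply (plus_minus (A := X)). }
  assert (defect : q (minus (Q x) (P x)) <= C * C * L * h * p x).
  { eapply Rle_trans; [apply q_upper|].
    rewrite <- norm_opp, opp_minus.
    pose proof (is_norm_ge_0 _ p_norm x) as p_ge0.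
    apply Rle_trans with (C * (L * h * (C * p x))); [|right; ring].
    apply Rmult_le_compat_l; [lra|].
    eapply Rle_trans; [apply P_near_Q|].
    apply Rmult_le_compat; auto using norm_ge_0. }
  rewrite split_Q.
  eapply Rle_trans; [apply (is_norm_triangle _ q_norm)|].
  eapply Rle_trans; [apply Rplus_le_compat; [apply P_growth | apply defect]|].
  rewrite <- Rmult_plus_distr_r.
  apply Rmult_le_compat_r; [apply (is_norm_ge_0 _ p_norm)|].
  apply exp_add_linear_le; [|exact h_ge0].
  apply Rmult_le_pos; nra.
Qed.

(** The errors committed before step [j] are all amplified by at most [E ^ j],
    whenever they occurred; this is where [1 <= E] enters. *)
Lemma discrete_gronwall (n : nat) (E b : R) (d : nat -> R)
  (E_ge1 : 1 <= E) (b_ge0 : 0 <= b)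
  (step : forall j, (j < n)%nat -> d (S j) <= E * d j + E ^ j * b) :
  forall j, (j <= n)%nat -> d j <= E ^ j * (d 0%nat + INR j * b).
Proof.
  induction j as [|j IH]; intros Hj.
  - simpl; lra.
  - eapply Rle_trans; [apply step; lia|].
    assert (IHj := IH ltac:(lia)).
    assert (Ej_pos : 0 < E ^ j) by (apply pow_lt; lra).
    rewrite S_INR. simpl.
    assert (E * d j <= E * (E ^ j * (d 0%nat + INR j * b)))
      by (apply Rmult_le_compat_l; lra).
    assert (E ^ j * b <= E * (E ^ j * b)).
    { pose proof (Rmult_le_pos _ _ (Rlt_le _ _ Ej_pos) b_ge0). nra. }
    lra.
Qed.

(** The difference of the two recursions obeys the first one, up to a defect
    evaluated along the second one, whose size is already known. The norms
    change from step to step, and giving both recursions the same factor [E]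
    makes the propagated defects all scale like [E ^ n]. *)
Lemma global_error {K : AbsRing} {X : NormedModule K} (n : nat)
  (p : nat -> X -> R) (P Q : nat -> X -> X) (x y : nat -> X) (C c E : R)
  (p_norm : forall j, (j <= n)%nat -> is_norm (p j)) (C_pos : 0 < C)
  (p_equiv : forall j z, (j <= n)%nat -> norm z <= C * p j z /\ p j z <= C * norm z)
  (E_ge1 : 1 <= E) (c_ge0 : 0 <= c)
  (P_linear : forall j, (j < n)%nat -> is_linear (P j))
  (P_growth : forall j z, (j < n)%nat -> p (S j) (P j z) <= E * p j z)
  (Q_growth : forall j z, (j < n)%nat -> p (S j) (Q j z) <= E * p j z)
  (P_near_Q : forall j z, (j < n)%nat -> norm (minus (P j z) (Q j z)) <= c * norm z)
  (x_rec : forall j, (j < n)%nat -> x (S j) = P j (x j))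
  (y_rec : forall j, (j < n)%nat -> y (S j) = Q j (y j)) :
  norm (minus (x n) (y n))
    <= C * C * E ^ n *
       (norm (minus (x 0%nat) (y 0%nat)) + C * C * (INR n * c) * norm (y 0%nat)).
Proof.
  assert (y_growth : forall j, (j <= n)%nat -> p j (y j) <= E ^ j * p 0%nat (y 0%nat)).
  { induction j as [|j IH]; intros Hj; [simpl; lra|].
    rewrite y_rec by lia.
    eapply Rle_trans; [apply Q_growth; lia|].
    simpl. rewrite Rmult_assoc.
    apply Rmult_le_compat_l; [lra | apply IH; lia]. }
  set (d := fun j => minus (x j) (y j)).
  set (b := C * c * (C * p 0%nat (y 0%nat))).
  assert (b_ge0 : 0 <= b).
  { pose proof (is_norm_ge_0 _ (p_norm 0%nat ltac:(lia)) (y 0%nat)).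
    unfold b. repeat apply Rmult_le_pos; lra. }
  assert (d_step : forall j, (j < n)%nat ->
            p (S j) (d (S j)) <= E * p j (d j) + E ^ j * b).
  { intros j Hj.
    assert (x_split : x j = plus (d j) (y j)).
    { unfold d. rewrite plus_comm. symmetry; apply (plus_minus (A := X)). }
    assert (d_split : d (S j) = plus (P j (d j)) (minus (P j (y j)) (Q j (y j)))).
    { unfold d at 1. rewrite x_rec, y_rec by exact Hj.
      rewrite x_split at 1. rewrite (linear_plus _ (P_linear j Hj)).
      unfold minus. symmetry; apply plus_assoc. }
    rewrite d_split.
    eapply Rle_trans; [apply (is_norm_triangle _ (p_norm (S j) ltac:(lia)))|].
    apply Rplus_le_compat; [apply P_growth, Hj|].
    eapply Rle_trans; [apply p_equiv; lia|].
    unfold b.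
    apply Rle_trans with (C * (c * (C * (E ^ j * p 0%nat (y 0%nat)))));
      [|right; ring].
    apply Rmult_le_compat_l; [lra|].
    eapply Rle_trans; [apply P_near_Q, Hj|].
    apply Rmult_le_compat_l; [lra|].
    eapply Rle_trans; [apply p_equiv with (j := j); lia|].
    apply Rmult_le_compat_l; [lra|].
    apply y_growth; lia. }
  pose proof (discrete_gronwall n E b (fun j => p j (d j)) E_ge1 b_ge0 d_step n
                (le_n n)) as d_bound.
  cbv beta in d_bound.
  destruct (p_equiv n (d n) (le_n n)) as [d_leave _].
  destruct (p_equiv 0%nat (d 0%nat) ltac:(lia)) as [_ d_enter].
  destruct (p_equiv 0%nat (y 0%nat) ltac:(lia)) as [_ y_enter].
  assert (En_pos : 0 < E ^ n) by (apply pow_lt; lra).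
  fold (d n) (d 0%nat).
  eapply Rle_trans; [exact d_leave|].
  apply Rle_trans with (C * (E ^ n * (C * norm (d 0%nat)
      + INR n * (C * c * (C * (C * norm (y 0%nat))))))); [|right; ring].
  apply Rmult_le_compat_l; [lra|].
  eapply Rle_trans; [exact d_bound|].
  apply Rmult_le_compat_l; [lra|].
  apply Rplus_le_compat; [exact d_enter|].
  apply Rmult_le_compat_l; [apply pos_INR|].
  unfold b.
  apply Rmult_le_compat_l; [apply Rmult_le_pos; lra|].
  apply Rmult_le_compat_l; [lra | exact y_enter].
Qed.

(** * Stability and convergence of the approximate evolution *)

Theorem theorem3p5
  (T : R) (hT : 0 < T)
  (k : scalar_kind) (X : CompleteNormedModule (scalar_field k))
  (V G : R -> R -> X -> X)
  (* [is_linear] means linear and bounded *)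
  (hV : forall t s, 0 <= s <= t /\ t <= T -> is_linear (V t s))
  (hG : forall t s, 0 <= s <= t /\ t <= T -> is_linear (G t s))
  (omega : R) (N : R -> X -> R)
  (hN : forall t, 0 <= t <= T -> is_norm (N t))
  (hNequiv : uniformly_equivalent T N)
  (hVbound : forall t s, 0 <= s <= t /\ t <= T ->
     Rbar_le (op_norm (N s) (N t) (V t s)) (exp (omega * (t - s))))
  (alpha C_G : R) (halpha : 1 <= alpha) (hC_G : 0 < C_G)
  (hVG : forall t s, 0 <= s <= t /\ t <= T ->
     Rbar_le (op_norm norm norm (fun x : X => minus (V t s x) (G t s x)))
             (C_G * rpow (t - s) alpha)) :
  (exists omega' : R, forall t s, 0 <= s <= t /\ t <= T ->
     Rbar_le (op_norm (N s) (N t) (G t s)) (exp (omega' * (t - s))))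
  /\
  (exists omega' C_V C_N : R, 0 < C_V /\ 0 < C_N /\
     forall (n : nat) (T0 : R) (x y : nat -> X),
       (1 <= n)%nat -> 0 <= T0 <= T ->
       let delta := T0 / INR n in
       (forall j : nat, (j < n)%nat ->
          x (S j) = V (INR (S j) * delta) (INR j * delta) (x j)) ->
       (forall j : nat, (j < n)%nat ->
          y (S j) = G (INR (S j) * delta) (INR j * delta) (y j)) ->
       norm (minus (x n) (y n)) <=
         C_V * exp (omega' * T0) *
           (norm (minus (x 0%nat) (y 0%nat))
            + C_N * (rpow T0 alpha / rpow (INR n) (alpha - 1)) * norm (y 0%nat))).
Proof.
  destruct hNequiv as [C [C_pos equiv]].
  assert (lower : forall t z, 0 <= t <= T -> norm z <= C * N t z).
  { intros t z Ht. destruct (equiv t z Ht) as [Hlow _].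
    apply (Rmult_le_compat_l C) in Hlow; [|lra].
    rewrite <- Rmult_assoc, Rinv_r, Rmult_1_l in Hlow by lra. exact Hlow. }
  assert (upper : forall t z, 0 <= t <= T -> N t z <= C * norm z).
  { intros t z Ht. apply (equiv t z Ht). }
  assert (V_growth : forall t s, 0 <= s <= t /\ t <= T ->
            forall z, N t (V t s z) <= exp (omega * (t - s)) * N s z).
  { intros t s Hts. apply op_norm_le_iff; [|left; apply exp_pos | apply hVbound, Hts].
    apply is_norm_ge_0, hN; lra. }
  assert (defect_ge0 : forall h, 0 <= C_G * rpow h alpha).
  { intros h. apply Rmult_le_pos; [lra | apply rpow_ge_0]. }
  assert (V_near_G : forall t s, 0 <= s <= t /\ t <= T ->
            forall z : X, norm (minus (V t s z) (G t s z))
                          <= C_G * rpow (t - s) alpha * norm z).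
  { intros t s Hts.
    apply (op_norm_le_iff (fun z : X => norm z) (fun z : X => norm z)
             (fun z => minus (V t s z) (G t s z))
             (C_G * rpow (t - s) alpha));
      [apply norm_ge_0 | apply defect_ge0 | apply hVG, Hts]. }
  set (L := C_G * Rpower T (alpha - 1)).
  assert (L_ge0 : 0 <= L).
  { apply Rmult_le_pos; [lra | left; apply exp_pos]. }
  set (w := Rabs omega + C * C * L).
  assert (w_ge : Rabs omega <= w).
  { unfold w. assert (0 <= C * C * L) by (apply Rmult_le_pos; nra). lra. }
  assert (G_growth : forall t s, 0 <= s <= t /\ t <= T ->
            forall z, N t (G t s z) <= exp (w * (t - s)) * N s z).
  { intros t s Hts z.
    apply (perturbed_growth (N s) (N t) (V t s) (G t s) C
             (C_G * rpow (t - s) alpha) omega L (t - s));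
      auto; try lra; try (apply hN; lra).
    - intros z'; apply lower; lra.
    - intros z'; apply upper; lra.
    - unfold L. rewrite Rmult_assoc.
      apply Rmult_le_compat_l; [lra | apply rpow_le_linear; lra]. }
  split.
  - exists w. intros t s Hts.
    apply op_norm_le_iff; [|left; apply exp_pos | apply G_growth, Hts].
    apply is_norm_ge_0, hN; lra.
  - exists w, (C * C), (C * C * C_G).
    split; [nra|]. split; [apply Rmult_lt_0_compat; nra|].
    intros n T0 x y n_ge1 T0_bounds delta x_rec y_rec.
    assert (n_pos : 0 < INR n) by (apply lt_0_INR; lia).
    assert (delta_ge0 : 0 <= delta).
    { unfold delta. apply Rmult_le_pos; [lra | left; apply Rinv_0_lt_compat, n_pos]. }
    assert (n_delta : INR n * delta = T0) by (unfold delta; field; lra).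
    assert (node : forall j, (j <= n)%nat -> 0 <= INR j * delta <= T).
    { intros j Hj. apply le_INR in Hj. pose proof (pos_INR j). nra. }
    assert (step : forall j, INR (S j) * delta - INR j * delta = delta).
    { intros j. rewrite S_INR; ring. }
    assert (step_bounds : forall j, (j < n)%nat ->
              0 <= INR j * delta <= INR (S j) * delta /\ INR (S j) * delta <= T).
    { intros j Hj. pose proof (node j ltac:(lia)). pose proof (node (S j) ltac:(lia)).
      pose proof (step j). lra. }
    assert (En : exp (w * T0) = exp (w * delta) ^ n).
    { rewrite <- Rpower_pow by apply exp_pos.
      unfold Rpower. rewrite ln_exp, <- n_delta. f_equal; ring. }
    rewrite <- sum_rpow_steps by (assumption || lra).
    fold delta. rewrite En.
    replace (C * C * C_G * (INR n * rpow delta alpha))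
      with (C * C * (INR n * (C_G * rpow delta alpha))) by ring.
    apply (global_error n (fun j => N (INR j * delta))
             (fun j => V (INR (S j) * delta) (INR j * delta))
             (fun j => G (INR (S j) * delta) (INR j * delta)));
      auto.
    + rewrite <- exp_0. apply exp_nondecreasing.
      apply Rmult_le_pos; [pose proof (Rabs_pos omega); lra | exact delta_ge0].
    + intros j z Hj.
      eapply Rle_trans; [apply V_growth; auto|]. rewrite step.
      apply Rmult_le_compat_r; [apply is_norm_ge_0, hN, node; lia|].
      apply exp_nondecreasing, Rmult_le_compat_r; [exact delta_ge0|].
      pose proof (RRle_abs omega); lra.
    + intros j z Hj.
      pose proof (G_growth _ _ (step_bounds j Hj) z) as Hj_step.
      rewrite step in Hj_step. exact Hj_step.
    + intros j z Hj.
      pose proof (V_near_G _ _ (step_bounds j Hj) z) as Hj_step.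
      rewrite step in Hj_step. exact Hj_step.
Qed.
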